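(* Let $\sigma>0$ and $\lambda>0$. Suppose $\Omega\subset\mathbb{R}^d$ is a compact set and let $c>0$ satisfy $\mathrm{diam}(\Omega)\le c$. There is a constant $A=A(\sigma,d,c)>0$ such that if $\alpha\in\mathcal{P}_\infty^\lambda(\mathbb{R}^d)$ and $\beta\in\mathcal{P}_\infty(\mathbb{R}^d)$ have their supports contained in $\Omega$, then the multiscale covariance tensor fields of $\alpha$ and $\beta$ associated with the truncation kernel satisfy $$\sup_{x\in\mathbb{R}^d}\|\Sigma_\alpha(x,\sigma)-\Sigma_\beta(x,\sigma)\|\le\lambda A\,W_\infty(\alpha,\beta).$$
   Context: $\mathcal{P}_\infty(\mathbb{R}^d)$ is the set of Borel probability measures on $\mathbb{R}^d$ with bounded support; $\mathcal{P}_\infty^\lambda(\mathbb{R}^d)$ is the subset of those $\alpha$ with $\alpha(A)\le\lambda\mathcal{L}(A)$ for all measurable $A$, $\mathcal{L}$ being Lebesgue measure. The truncation kernel is $T(x,y,\sigma)=\frac{1}{\sigma^d\nu_d}\chi\!\left(\frac{\|y-x\|^2}{\sigma^2}\right)$, where $\chi$ is the characteristic function of $[0,1]$ and $\nu_d$ is the volume of the unit ball in $\mathbb{R}^d$. The covariance tensor field associated with $T$ is $\Sigma_\alpha(x,\sigma)=\int(y-x)\otimes(y-x)\,T(x,y,\sigma)\,\alpha(dy)\in\mathbb{R}^d\otimes\mathbb{R}^d$; identifying $x\otimes y$ with $xy^T$, $\|\cdot\|$ is the Frobenius norm. $\Gamma(\alpha,\beta)$ is the set of couplings of $\alpha$ and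 $\beta$ (probability measures on $\mathbb{R}^d\times\mathbb{R}^d$ with marginals $\alpha,\beta$), and $W_\infty(\alpha,\beta)=\inf_{\mu\in\Gamma(\alpha,\beta)}\sup\{\|z_1-z_2\|:(z_1,z_2)\in\mathrm{supp}[\mu]\}$. *)

(* Defs.v *)
From HB Require Import structures.
From mathcomp Require Import all_boot all_order all_algebra.
From mathcomp Require Import all_classical all_reals all_analysis.
Set Implicit Arguments.
Unset Strict Implicit.
Unset Printing Implicit Defensive.
Import Order.TTheory GRing.Theory Num.Theory.
Import numFieldNormedType.Exports.
Local Open Scope classical_set_scope.
Local Open Scope ring_scope.

(* Points of R^d are row vectors 'rV[R]_d, with the library's matrix topology
   (the usual topology of R^d) and its Borel sigma-algebra. *)
HB.instance Definition _ (R : realType) (m n : nat) :=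
  Measurable.copy 'M[R]_(m, n) (g_sigma_algebraType (@open 'M[R]_(m, n))).

(* The library norm `|A| on matrices is the sup norm; fnorm is the Frobenius
   norm, hence the Euclidean norm on row vectors. *)
Definition fnorm (R : realType) (m n : nat) (A : 'M[R]_(m, n)) : R :=
  Num.sqrt (\sum_i \sum_j A i j ^+ 2).

(* With row vectors, x (x) y is x^T *m y, the matrix of entries x_i y_j. *)
Definition tensor (R : realType) (d : nat) (x y : 'rV[R]_d) : 'M[R]_d :=
  x^T *m y.

(* Lebesgue measure on the Borel sets of R^d, as the d-fold product of the
   one-dimensional one: R^0 is a point of mass 1, and the product measure on
   R^(1+n) = R x R^n integrates the measure of the slices. *)
Fixpoint lebesgue_rV (R : realType) (d : nat) : set 'rV[R]_d -> \bar R :=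
  match d with
  | 0%N => fun A => \d_(0 : 'rV[R]_0) A
  | n.+1 => fun A => (\int[@lebesgue_measure R]_t
      lebesgue_rV [set v : 'rV[R]_n |
        A (row_mx ((t : R)%:M : 'rV[R]_1) v : 'rV[R]_(1 + n))])%E
  end.

Definition unit_ball_volume (R : realType) (d : nat) : R :=
  fine (lebesgue_rV [set x : 'rV[R]_d | fnorm x <= 1]).

Definition supp (R : realType) (X : topologicalType) (mu : set X -> \bar R) :
    set X :=
  [set x | forall U : set X, open U -> U x -> (0 < mu U)%E].

Definition Pinfty (R : realType) (d : nat) (alpha : probability 'rV[R]_d R) :
    Prop :=
  bounded_set (supp (alpha : set 'rV[R]_d -> \bar R)).

Definition Pinfty_lambda (R : realType) (d : nat) (lambda : R)
    (alpha : probability 'rV[R]_d R) : Prop :=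
  Pinfty alpha /\
  forall A : set 'rV[R]_d, measurable A ->
    (alpha A <= lambda%:E * lebesgue_rV A)%E.

Definition trunc_kernel (R : realType) (d : nat) (x y : 'rV[R]_d) (sigma : R) :
    R :=
  (sigma ^+ d * unit_ball_volume R d)^-1 *
  \1_(`[0, 1] : set R) (fnorm (y - x) ^+ 2 / sigma ^+ 2).

Definition cov_field (R : realType) (d : nat) (alpha : probability 'rV[R]_d R)
    (x : 'rV[R]_d) (sigma : R) : 'M[R]_d :=
  \matrix_(i, j)
    \int[alpha]_y (tensor (y - x) (y - x) i j * trunc_kernel x y sigma).

Definition coupling (R : realType) (d : nat) (alpha beta : probability 'rV[R]_d R)
    (mu : probability ('rV[R]_d * 'rV[R]_d)%type R) : Prop :=
  (forall A : set 'rV[R]_d, measurable A -> pushforward mu fst A = alpha A) /\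
  (forall B : set 'rV[R]_d, measurable B -> pushforward mu snd B = beta B).

Definition Winfty (R : realType) (d : nat) (alpha beta : probability 'rV[R]_d R) :
    \bar R :=
  ereal_inf [set ereal_sup [set (fnorm (z.1 - z.2))%:E |
                             z in supp (mu : set ('rV[R]_d * 'rV[R]_d) -> \bar R)]
            | mu in [set mu | coupling alpha beta mu]].

(* Equal to -oo when Om is empty. *)
Definition diam (R : realType) (d : nat) (Om : set 'rV[R]_d) : \bar R :=
  ereal_sup [set (fnorm (z.1 - z.2))%:E | z in Om `*` Om].

(* Main.v *)
(* Fix a coupling mu of alpha and beta and let delta be the supremum of
   |z1 - z2| over its support. By second countability mu-almost every z
   satisfies |z1 - z2| <= delta, and delta <= c because the support of mu lies
   in Om x Om. Pointwise, the truncated tensors at z1 and z2 differ by at most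
   2 sigma delta when |z1 - x| <= sigma, plus sigma^2 when z1 lies in the shell
   sigma - delta < |z1 - x| <= sigma + delta, the only place where truncation
   can separate z1 from z2. Both bounds depend on z1 only, so they integrate
   against alpha <= lambda L, and the ball and the shell have Lebesgue measure
   O(1) and O(delta).

   The iterated integral defining L needs no measurability of slices here:
   integrals of nonnegative functions are suprema over simple functions below,
   hence monotone and superadditive for arbitrary functions. Superadditivity
   bounds the shell by the difference of two balls, whose measures are given by
   scaling. *)
Require Import Defs.
From HB Require Import structures.
From mathcomp Require Import all_boot all_order all_algebra.
From mathcomp Require Import all_classical all_reals all_analysis.
From mathcomp Require Import measurable_realfun ring.
Set Implicit Arguments.
Unset Strict Implicit.
Unset Printing Implicit Defensive.
Import Order.TTheory GRing.Theory Num.Theory.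
Import numFieldNormedType.Exports.
Local Open Scope classical_set_scope.
Local Open Scope ring_scope.

(** * The Frobenius norm: triangle inequality and comparison with the entries *)

Section fnorm_theory.
Context (R : realType).

Lemma sum_sqr_ge0 m n (A : 'M[R]_(m, n)) : 0 <= \sum_i \sum_j A i j ^+ 2.
Proof. by do 2 (apply: sumr_ge0 => ? _); rewrite sqr_ge0. Qed.

Lemma fnorm_ge0 m n (A : 'M[R]_(m, n)) : 0 <= fnorm A.
Proof. exact: sqrtr_ge0. Qed.

Lemma sqr_fnorm m n (A : 'M[R]_(m, n)) : fnorm A ^+ 2 = \sum_i \sum_j A i j ^+ 2.
Proof. by rewrite sqr_sqrtr// sum_sqr_ge0. Qed.

Lemma fnormZ m n (k : R) (A : 'M[R]_(m, n)) : fnorm (k *: A) = `|k| * fnorm A.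
Proof.
rewrite /fnorm -sqrtr_sqr -sqrtrM ?sqr_ge0// mulr_sumr; congr Num.sqrt.
apply: eq_bigr => i _; rewrite mulr_sumr; apply: eq_bigr => j _.
by rewrite mxE exprMn.
Qed.

Lemma fnormN m n (A : 'M[R]_(m, n)) : fnorm (- A) = fnorm A.
Proof. by rewrite -scaleN1r fnormZ normrN1 mul1r. Qed.

Lemma norm_coord_fnorm m n (A : 'M[R]_(m, n)) i j : `|A i j| <= fnorm A.
Proof.
rewrite -sqrtr_sqr ler_wsqrtr// (bigD1 i)//= (bigD1 j)//= -addrA lerDl.
rewrite addr_ge0//; first by apply: sumr_ge0 => ? _; rewrite sqr_ge0.
by do 2 (apply: sumr_ge0 => ? _); rewrite sqr_ge0.
Qed.

Lemma fnorm_le_coord n (A : 'M[R]_n) (M : R) :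
  (forall i j, `|A i j| <= M) -> fnorm A <= n%:R * M.
Proof.
(* An empty matrix puts no constraint on [M], which may then be negative; both sides are zero. *)
case: n A => [|n] A AM; first by rewrite mul0r /fnorm big_ord0 sqrtr0.
have M0 : 0 <= M by exact: le_trans (AM ord0 ord0).
have -> : n.+1%:R * M = Num.sqrt ((n.+1%:R * M) ^+ 2).
  by rewrite sqrtr_sqr ger0_norm// mulr_ge0.
rewrite ler_wsqrtr//.
have -> : (n.+1%:R * M) ^+ 2 = \sum_(i < n.+1) \sum_(j < n.+1) M ^+ 2.
  by rewrite !sumr_const !card_ord -mulrnA exprMn -[RHS]mulr_natl natrM expr2.
apply: ler_sum => i _; apply: ler_sum => j _.
by rewrite -(real_normK (num_real (A i j))) ler_pXn2r ?nnegrE.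
Qed.

Lemma sum_cauchy_schwarz (I : finType) (a b : I -> R) :
  (\sum_i a i * b i) ^+ 2 <= (\sum_i a i ^+ 2) * (\sum_i b i ^+ 2).
Proof.
have a0 : 0 <= \sum_i a i ^+ 2 by apply: sumr_ge0 => i _; rewrite sqr_ge0.
have [a_eq0|an0] := eqVneq (\sum_i a i ^+ 2) 0.
  have ai0 i : a i = 0.
    apply/eqP; rewrite -sqrf_eq0; move/eqP: a_eq0.
    rewrite psumr_eq0 => [/allP/(_ i)|j _]; last exact: sqr_ge0.
    by rewrite mem_index_enum => /(_ isT)/implyP; apply.
  by rewrite big1 ?a_eq0 ?expr0n ?mul0r// => i _; rewrite ai0 mul0r.
(* With [P] positive, the inequality is read off from a nonnegative sum of squares, which expands to
   [P] times the difference of the two sides. *)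
set S := \sum_i a i * b i; set P := \sum_i a i ^+ 2.
have : 0 <= \sum_i (P * b i - S * a i) ^+ 2.
  by apply: sumr_ge0 => i _; rewrite sqr_ge0.
have E (x y : R) : \sum_i (x * b i - y * a i) ^+ 2 =
    x ^+ 2 * (\sum_i b i ^+ 2) - (2 * x * y) * S + y ^+ 2 * P.
  by rewrite !mulr_sumr -sumrB -big_split/=; apply: eq_bigr => i _; ring.
have -> : \sum_i (P * b i - S * a i) ^+ 2 =
    P * (P * (\sum_i b i ^+ 2) - S ^+ 2).
  rewrite E; ring.
by rewrite pmulr_rge0 ?subr_ge0// lt_def an0.
Qed.

Lemma fnormD n (u v : 'rV[R]_n) : fnorm (u + v) <= fnorm u + fnorm v.
Proof.
rewrite -(@ler_pXn2r _ 2) ?nnegrE ?addr_ge0 ?fnorm_ge0// sqrrD !sqr_fnorm !big_ord1.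
have -> : \sum_j (u + v) 0 j ^+ 2 = \sum_j u 0 j ^+ 2 +
    (\sum_j u 0 j * v 0 j) *+ 2 + \sum_j v 0 j ^+ 2.
  rewrite -sumrMnl -!big_split/=; apply: eq_bigr => i _.
  by rewrite mxE sqrrD.
rewrite lerD2r lerD2l lerMn2r/= (le_trans (ler_norm _))//.
rewrite -(@ler_pXn2r _ 2) ?nnegrE ?mulr_ge0 ?fnorm_ge0// -normrX.
rewrite ger0_norm ?sqr_ge0// exprMn !sqr_fnorm !big_ord1.
exact: sum_cauchy_schwarz.
Qed.

End fnorm_theory.

(** * Integrals of arbitrary nonnegative functions, as suprema over simple functions *)

Section lower_integral.
Local Open Scope ereal_scope.
Context d (T : measurableType d) (R : realType).
Variable mu : {measure set T -> \bar R}.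
Implicit Types f g : T -> \bar R.

Import HBNNSimple.

Lemma ge0_integral_leP f M : (forall x, 0 <= f x) ->
  (forall h : {nnsfun T >-> R}, (forall x, (h x)%:E <= f x) ->
     \int[mu]_x (h x)%:E <= M) ->
  \int[mu]_x f x <= M.
Proof.
move=> f0 hM; rewrite ge0_integralTE//; apply: ge_ereal_sup => _ [h hf <-].
by have := hM h hf; rewrite integral_nnsfun// patch_setT.
Qed.

Lemma ge0_le_integral_nomeas f g : (forall x, 0 <= f x) ->
  (forall x, f x <= g x) -> \int[mu]_x f x <= \int[mu]_x g x.
Proof.
move=> f0 fg; have g0 x : 0 <= g x by exact: le_trans (fg x).
rewrite !ge0_integralTE//; apply: ereal_sup_le => _ [h hf <-].
by exists h => // x; exact: le_trans (fg x).
Qed.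

(** If simple functions [h] and [k] lie below [f] and [g], then [h + k] is a simple function below
    [f + g], and additivity holds for [h] and [k]. *)
Lemma ge0_integral_superadditive f g :
  (forall x, 0 <= f x) -> (forall x, 0 <= g x) ->
  \int[mu]_x f x + \int[mu]_x g x <= \int[mu]_x (f x + g x).
Proof.
move=> f0 g0; set M := \int[mu]_x (f x + g x).
have M0 : 0 <= M by apply: integral_ge0 => x _; rewrite adde_ge0.
have [->|Moo] := eqVneq M +oo; first by rewrite leey.
have Mfin : M \is a fin_num by rewrite ge0_fin_numE// ltey.
have hk (h k : {nnsfun T >-> R}) : (forall x, (h x)%:E <= f x) ->
    (forall x, (k x)%:E <= g x) ->
    \int[mu]_x (h x)%:E + \int[mu]_x (k x)%:E <= M.
  move=> hf kg; rewrite -ge0_integralD//.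
  - by apply: ge0_le_integral_nomeas => x; rewrite ?adde_ge0 ?leeD ?lee_fin.
  - by move=> x _; rewrite lee_fin.
  - exact/measurable_EFinP.
  - by move=> x _; rewrite lee_fin.
  - exact/measurable_EFinP.
have fM : \int[mu]_x f x <= M.
  by apply: ge0_le_integral_nomeas => // x; rewrite leeDl.
have ffin : \int[mu]_x f x \is a fin_num.
  by rewrite ge0_fin_numE ?(le_lt_trans fM) ?ltey// integral_ge0.
(* The suprema over [k] and then over [h] are taken one at a time, the other integral being moved to
   the right; this subtraction requires it to be finite. *)
rewrite addeC -leeBrDr//; apply: ge0_integral_leP => // k kg.
have kfin : \int[mu]_x (k x)%:E \is a fin_num.
  rewrite ge0_fin_numE; last by apply: integral_ge0 => x _; rewrite lee_fin.
  rewrite (@le_lt_trans _ _ M) ?ltey//.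
  apply: ge0_le_integral_nomeas => x; first by rewrite lee_fin.
  by rewrite (le_trans (kg x))// leeDr.
rewrite leeBrDr// addeC -leeBrDr//; apply: ge0_integral_leP => // h hf.
by rewrite leeBrDr//; exact: hk.
Qed.

(** One inequality is shown for every positive factor; the other is the same one for [c^-1] and the
    function [c * f]. *)
Lemma ge0_integralZl_nomeas f (c : R) : (0 < c)%R -> (forall x, 0 <= f x) ->
  \int[mu]_x (c%:E * f x) = c%:E * \int[mu]_x f x.
Proof.
have le g (k : R) : (0 < k)%R -> (forall x, 0 <= g x) ->
    \int[mu]_x (k%:E * g x) <= k%:E * \int[mu]_x g x.
  move=> k0 g0; apply: ge0_integral_leP => [x|h hg].
    by rewrite mule_ge0// lee_fin ltW.
  rewrite -lee_pdivrMl// -ge0_integralZl_EFin//; last 3 first.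
  - by move=> x _; rewrite lee_fin.
  - exact/measurable_EFinP.
  - by rewrite invr_ge0 ltW.
  apply: ge0_le_integral_nomeas => x.
    by rewrite mule_ge0// lee_fin// invr_ge0 ltW.
  by rewrite lee_pdivrMl.
move=> c0 f0; apply/eqP; rewrite eq_le le//=.
have cV0 : (0 < c^-1)%R by rewrite invr_gt0.
rewrite -lee_pdivlMl//; apply: le_trans (le (fun x => c%:E * f x) _ cV0 _); last first.
  by move=> x; rewrite mule_ge0// lee_fin ltW.
apply: ge0_le_integral_nomeas => // x.
by rewrite muleA -EFinM mulVf ?gt_eqF// mul1e lexx.
Qed.

End lower_integral.

(** * Affine change of variable on the line *)

Section lebesgue_affine.
Local Open Scope ereal_scope.
Context (R : realType) (q r : R).
Hypothesis r0 : (0 < r)%R.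
Local Notation mu := (@lebesgue_measure R).

Let phi (s : measurableTypeR R) : measurableTypeR R := ((s - q) / r)%R.

Let mphi : measurable_fun [set: measurableTypeR R] phi.
Proof.
apply: measurable_funM => //; apply: measurable_funB => //.
Qed.

Let pushphi : {measure set (measurableTypeR R) -> \bar R} :=
  measure_function_pushforward__canonical__measure_function_Measure mu mphi.

Let rV0 : (0 <= r^-1)%R. Proof. by rewrite invr_ge0 ltW. Qed.

(** Uniqueness of Lebesgue measure reduces this to half-open intervals. Since [phi] inverts
    [t |-> q + r * t], the preimage of an interval is [r] times as long, which the factor [r^-1]
    compensates. *)
Lemma lebesgue_measure_affine (A : set (measurableTypeR R)) : measurable A ->
  mu A = mscale (NngNum rV0) pushphi A.
Proof.
apply: lebesgue_measure_unique => _ [[a b] _ <-].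
have phiE : phi @^-1` `]a, b] = `](q + r * a)%R, (q + r * b)%R]%classic.
  apply/seteqP; split=> s /=; rewrite !in_itv/= /phi ltr_pdivlMr// ler_pdivrMr//
    ltrBrDr lerBlDr ![(q + _)%R]addrC !(mulrC r)//.
transitivity ((r^-1)%:E * mu (phi @^-1` `]a, b])); last by [].
rewrite phiE !lebesgue_measure_itv/= !lte_fin ltrD2l ltr_pM2l//.
case: ifPn => _; rewrite ?mule0// -!EFinB -EFinM; congr (_%:E).
by rewrite opprD addrACA subrr add0r -mulrBr mulrA mulVf ?gt_eqF// mul1r.
Qed.

Import HBNNSimple.

(** The change of variable is exact for a simple [h] below [t |-> f (q + r * t)], and [h] composed
    with [phi] lies below [f]. *)
Lemma ge0_integral_affine_le (f : R -> \bar R) : (forall x, 0 <= f x) ->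
  \int[mu]_t f (q + r * t)%R <= (r^-1)%:E * \int[mu]_t f t.
Proof.
move=> f0; apply: ge0_integral_leP => // h hf.
rewrite (@eq_measure_integral _ _ _ _ (mscale (NngNum rV0) pushphi));
  last by move=> A mA _; exact: lebesgue_measure_affine.
have mh : measurable_fun [set: measurableTypeR R] (EFin \o h).
  exact/measurable_EFinP.
rewrite ge0_integral_mscale//=; last by move=> x _; rewrite lee_fin.
rewrite (ge0_integral_pushforward mphi mu measurableT mh); last first.
  by move=> x _; rewrite lee_fin.
rewrite preimage_setT lee_pmul2l ?fin_numE// ?lte_fin ?invr_gt0//.
apply: ge0_le_integral_nomeas => x /=; first by rewrite lee_fin.
rewrite (le_trans (hf _))// /phi mulrC divfK ?gt_eqF// addrC subrK.
exact: lexx.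
Qed.

End lebesgue_affine.

(** The reverse inequality is the preceding bound for the inverse map [t |-> - q / r + r^-1 * t]. *)
Lemma ge0_integral_affine (R : realType) (q r : R) (f : R -> \bar R) :
  0 < r -> (forall x, 0 <= f x)%E ->
  (\int[@lebesgue_measure R]_t f (q + r * t)%R =
   (r^-1)%:E * \int[@lebesgue_measure R]_t f t)%E.
Proof.
move=> r0 f0; apply/eqP; rewrite eq_le ge0_integral_affine_le//=.
have rV0 : 0 < r^-1 by rewrite invr_gt0.
have := @ge0_integral_affine_le R (- q / r) _ rV0 (fun t => f (q + r * t)) (fun=> f0 _).
rewrite invrK -lee_pdivrMl//; apply: le_trans.
rewrite lee_pmul2l ?lte_fin// le_eqVlt; apply/orP; left; apply/eqP.
apply: eq_integral => t _; congr f.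
by rewrite mulrDr mulrCA divff ?gt_eqF// mulr1 mulVKf ?gt_eqF// addrA subrr add0r.
Qed.

(** * Lebesgue measure in dimension [d]: monotonicity, superadditivity, scaling, balls *)

Section lebesgue_rV_theory.
Context (R : realType).
Local Notation mu := (@lebesgue_measure R).

Lemma lebesgue_rV_ge0 d (A : set 'rV[R]_d) : (0 <= lebesgue_rV A)%E.
Proof.
elim: d A => [|n IHn] A; first exact: measure_ge0.
by apply: integral_ge0 => t _; exact: IHn.
Qed.

Lemma le_lebesgue_rV d (A B : set 'rV[R]_d) : A `<=` B ->
  (lebesgue_rV A <= lebesgue_rV B)%E.
Proof.
elim: d A B => [|n IHn] A B AB.
  by rewrite /= !diracE lee_fin ler_nat; case: (boolP (0 \in A)) => //;
    rewrite inE => /AB/mem_set ->.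
apply: ge0_le_integral_nomeas => t; first exact: lebesgue_rV_ge0.
by apply: IHn => v /AB.
Qed.

(** Slices of disjoint sets are disjoint, so superadditivity of the integral carries the induction;
    in dimension 0 at most one of the two sets contains the only point. *)
Lemma lebesgue_rV_superadditive d (A B : set 'rV[R]_d) : A `&` B = set0 ->
  (lebesgue_rV A + lebesgue_rV B <= lebesgue_rV (A `|` B))%E.
Proof.
elim: d A B => [|n IHn] A B AB0.
  rewrite /= !diracE in_setU.
  case: (boolP (0 \in A)) => [|_]; last by rewrite add0e lexx.
  case: (boolP (0 \in B)) => [|_]; last by rewrite adde0 lexx.
  rewrite !inE => B0 A0; suff: set0 (0 : 'rV[R]_0) by [].
  by rewrite -AB0.
apply: le_trans (ge0_integral_superadditive _ _ _) _ => [t|t|].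
- exact: lebesgue_rV_ge0.
- exact: lebesgue_rV_ge0.
apply: ge0_le_integral_nomeas => t; first by rewrite adde_ge0 ?lebesgue_rV_ge0.
apply: IHn; apply/seteqP; split=> // v [Av Bv].
suff: set0 (row_mx t%:M v) by [].
by rewrite -AB0.
Qed.

(** The map acts separately on the first coordinate and on the rest: the induction hypothesis gives
    [r ^- n] on each slice, and the outer integral gives one more [r^-1]. *)
Lemma lebesgue_rV_affine d (A : set 'rV[R]_d) (p : 'rV[R]_d) (r : R) : 0 < r ->
  lebesgue_rV [set v | A (p + r *: v)] = ((r ^- d)%:E * lebesgue_rV A)%E.
Proof.
move=> r0; elim: d A p => [|n IHn] A p.
  rewrite expr0 invr1 mul1e; congr (lebesgue_rV _).
  by apply/seteqP; split=> v /=; rewrite (thinmx0 (p + _)) (thinmx0 v).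
(* Retyped with [1 + n] columns, so that the block operations apply. *)
pose p' : 'rV[R]_(1 + n) := p.
pose f (s : R) := lebesgue_rV [set v : 'rV[R]_n | A (row_mx (s%:M : 'rV[R]_1) v)].
transitivity (\int[mu]_t ((r ^- n)%:E * f (p' 0 0 + r * t)%R))%E.
  apply: eq_integral => t _; rewrite /f -(IHn _ (rsubmx p')).
  congr (lebesgue_rV _); apply/seteqP.
  have E (v : 'rV[R]_n) : p' + r *: row_mx (t%:M : 'rV[R]_1) v =
      (row_mx ((p' 0 0 + r * t)%:M : 'rV[R]_1) (rsubmx p' + r *: v)).
    rewrite -[p' in LHS](hsubmxK p') scale_row_mx add_row_mx; congr row_mx.
    apply/rowP => i; rewrite !mxE !ord1 /= mulr1n; congr (p' _ _ + _).
    exact: val_inj.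
  by split=> v /=; rewrite -E.
have f0 s : (0 <= f s)%E by exact: lebesgue_rV_ge0.
transitivity ((r ^- n)%:E * \int[mu]_t f (p' 0 0 + r * t)%R)%E; last first.
  by rewrite ge0_integral_affine// muleA -EFinM -invfM mulrC -exprS.
by rewrite ge0_integralZl_nomeas// invr_gt0 exprn_gt0.
Qed.

Lemma lebesgue_rV_ball d (p : 'rV[R]_d) (r : R) : 0 < r ->
  lebesgue_rV [set v : 'rV[R]_d | (fnorm (v - p) <= r)%R] =
  ((r ^+ d)%:E * lebesgue_rV [set v : 'rV[R]_d | (fnorm v <= 1)%R])%E.
Proof.
move=> r0; have rd0 : 0 < r ^+ d by rewrite exprn_gt0.
have E := esym (lebesgue_rV_affine [set v | (fnorm (v - p) <= r)%R] p r0).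
transitivity ((r ^+ d)%:E * ((r ^- d)%:E *
    lebesgue_rV [set v : 'rV[R]_d | (fnorm (v - p) <= r)%R]))%E.
  by rewrite muleA -EFinM mulfV ?gt_eqF// mul1e.
rewrite E; congr (_ * lebesgue_rV _)%E.
apply/seteqP; split => v /=; rewrite addrAC subrr add0r fnormZ gtr0_norm//.
  by rewrite -{2}(mulr1 r) ler_pM2l.
by move=> v1; rewrite -[leRHS]mulr1 ler_pM2l.
Qed.

Lemma lebesgue_rV0 d : lebesgue_rV (@set0 'rV[R]_d) = 0%E.
Proof.
elim: d => [|n IHn]; first by rewrite /= dirac0.
by rewrite -[RHS](@integral0 _ _ _ mu setT); apply: eq_integral => t _; rewrite -IHn.
Qed.

(** The cube contains the unit ball, whose volume is therefore finite. Slices at [t] outside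
    [[-1, 1]] are empty, so each dimension contributes a factor of at most 2. *)
Lemma lebesgue_rV_cube d :
  (lebesgue_rV [set v : 'rV[R]_d | forall i, (`|v 0 i| <= 1)%R] <= (2 ^+ d)%:E)%E.
Proof.
elim: d => [|n IHn]; first by rewrite expr0 /= diracE lee_fin lern1 leq_b1.
have le t : (lebesgue_rV [set v : 'rV[R]_n | forall i,
      (`|row_mx ((t : R)%:M : 'rV[R]_1) v 0 i| <= 1)%R] <=
    (2 ^+ n)%:E * (\1_(`[(-1), 1]%classic : set R) t)%:E)%E.
  rewrite indicE; have [|tn] := boolP (t \in _) => /=.
    rewrite mule1 => _; apply: le_trans IHn; apply: le_lebesgue_rV => v vt i.
    by have := vt (rshift 1 i); rewrite row_mxEr.
  rewrite mule0 (_ : mkset _ = set0) ?lebesgue_rV0//.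
  apply/seteqP; split=> // v /(_ (lshift n ord0)); rewrite row_mxEl mxE /= mulr1n.
  by move=> t1; move: tn; rewrite notin_setE/= in_itv/= -ler_norml.
rewrite [lebesgue_rV _]/=.
apply: le_trans (ge0_le_integral_nomeas mu (fun t => lebesgue_rV_ge0 _) le) _.
rewrite ge0_integralZl_EFin//; last first.
  by apply/measurable_EFinP; exact: measurable_indic.
rewrite integral_indic// setIT.
have muE : mu `[(-1)%R, 1%R]%classic = 2%:E.
  by rewrite lebesgue_measure_itv/= lte_fin -EFinB opprK gtrN.
rewrite [X in (_ * X)%E](_ : _ = 2%:E); last exact: muE.
by rewrite -EFinM lee_fin exprSr.
Qed.

Lemma lebesgue_rV_unit_ball_lty d :
  (lebesgue_rV [set v : 'rV[R]_d | (fnorm v <= 1)%R] < +oo)%E.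
Proof.
apply: le_lt_trans (ltry (2 ^+ d)).
apply: le_trans (lebesgue_rV_cube d); apply: le_lebesgue_rV => v /= v1 i.
exact: le_trans (norm_coord_fnorm _ _ _) v1.
Qed.

(** By finiteness, the [fine] in [unit_ball_volume] loses nothing. *)
Lemma lebesgue_rV_unit_ball d :
  lebesgue_rV [set v : 'rV[R]_d | (fnorm v <= 1)%R] = (unit_ball_volume R d)%:E.
Proof.
by rewrite fineK// ge0_fin_numE ?lebesgue_rV_ge0// lebesgue_rV_unit_ball_lty.
Qed.

Lemma unit_ball_volume_ge0 d : 0 <= unit_ball_volume R d.
Proof. by rewrite fine_ge0// lebesgue_rV_ge0. Qed.
End lebesgue_rV_theory.

(** * Volume of spherical shells *)

Lemma subrX_le (R : realDomainType) (a b : R) d : 0 <= a -> a <= b ->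
  b * (b ^+ d - a ^+ d) <= d%:R * b ^+ d * (b - a).
Proof.
move=> a0 ab; have b0 : 0 <= b by exact: le_trans ab.
(* This is the mean value bound multiplied by [b], which avoids the exponent [d - 1]. The induction
   splits the difference of powers as [b * (b ^+ d - a ^+ d) + a ^+ d * (b - a)]. *)
elim: d => [|d IHd]; first by rewrite !expr0 subrr mulr0 !mul0r.
have -> : b * (b ^+ d.+1 - a ^+ d.+1) =
    b * (b * (b ^+ d - a ^+ d)) + b * a ^+ d * (b - a) by rewrite !exprS; ring.
have -> : d.+1%:R * b ^+ d.+1 * (b - a) =
    b * (d%:R * b ^+ d * (b - a)) + b * b ^+ d * (b - a).
  by rewrite -natr1 exprS; ring.
rewrite lerD ?ler_wpM2l// ler_wpM2r ?subr_ge0// ler_wpM2l//.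
by rewrite lerXn2r ?nnegrE.
Qed.

Section annulus.
Context (R : realType) (d : nat).
Implicit Types (p : 'rV[R]_d) (a b : R).
Local Notation nu := (unit_ball_volume R d).

(** The inner sphere is excluded, so that the shell is disjoint from the closed ball of radius
    [a]. *)
Definition annulus p a b := [set v : 'rV[R]_d | a < fnorm (v - p) <= b].

Lemma lebesgue_rV_annulus p a b : 0 < a -> a <= b ->
  (lebesgue_rV (annulus p a b) <= ((b ^+ d - a ^+ d) * nu)%:E)%E.
Proof.
move=> a0 ab; have b0 : 0 < b by exact: lt_le_trans ab.
have := @lebesgue_rV_superadditive R d (annulus p a b)
  [set v | (fnorm (v - p) <= a)%R] _.
have /le_lebesgue_rV : annulus p a b `|` [set v | fnorm (v - p) <= a] `<=`
    [set v | fnorm (v - p) <= b].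
  by move=> v [/andP[]//|/= /le_trans]; apply.
rewrite !lebesgue_rV_ball// lebesgue_rV_unit_ball -!EFinM => U sup.
rewrite mulrBl EFinB leeBrDr//; apply: le_trans U; apply: sup.
apply/seteqP; split=> // v [/andP[av _] /= va].
by move: (lt_le_trans av va); rewrite ltxx.
Qed.

(* Small shells by the mean value bound on [r ^+ d]; a shell of half-width
   [delta >= sigma] may be the whole ball, whose volume is then at most
   [delta / sigma] times itself. *)
Lemma lebesgue_rV_shell p (sigma delta c : R) :
  0 < sigma -> 0 <= delta -> delta <= c ->
  (lebesgue_rV (annulus p (sigma - delta) (sigma + delta)) <=
   ((d.*2.+1)%:R * (sigma + c) ^+ d / sigma * nu * delta)%:E)%E.
Proof.
move=> s0 d0 dc; have nu0 := unit_ball_volume_ge0 R d.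
have sd0 : 0 < sigma + delta by rewrite ltr_pwDl.
have sdc : (sigma + delta) ^+ d <= (sigma + c) ^+ d.
  by rewrite lerXn2r ?nnegrE ?lerD2l// ltW// (lt_le_trans sd0)// lerD2l.
have mp : sigma - delta <= sigma + delta by rewrite lerD2l ge0_cp.
have sc0 : 0 <= (sigma + c) ^+ d.
  by apply: le_trans sdc; rewrite exprn_ge0 ?ltW.
have [sled|dlts] := leP sigma delta.
  apply: (@le_trans _ _ (lebesgue_rV [set v | fnorm (v - p) <= sigma + delta])).
    by apply: le_lebesgue_rV => v /andP[].
  rewrite lebesgue_rV_ball// lebesgue_rV_unit_ball -EFinM lee_fin.
  have : (sigma + delta) ^+ d * nu <= (sigma + c) ^+ d * nu by rewrite ler_wpM2r.
  move/le_trans; apply.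
  (* The constant must be at least 1 here, also for [d = 0]: hence the successor in [d.*2.+1]. *)
  have -> : (d.*2.+1)%:R * (sigma + c) ^+ d / sigma * nu * delta =
    (sigma + c) ^+ d * nu * ((d.*2.+1)%:R * (delta / sigma)) by ring.
  rewrite ler_peMr ?mulr_ge0// mulr_ege1 ?ler1n//.
  by rewrite ler_pdivlMr// mul1r.
apply: le_trans (lebesgue_rV_annulus _ _ _) _; [by rewrite subr_gt0| |].
  exact: mp.
rewrite lee_fin [leRHS]mulrAC ler_wpM2r//.
rewrite -(ler_pM2l s0).
have : sigma * ((sigma + delta) ^+ d - (sigma - delta) ^+ d) <=
    d%:R * (sigma + delta) ^+ d * (sigma + delta - (sigma - delta)).
  apply: le_trans (subrX_le _ _ _); last 2 first.
  - by rewrite subr_ge0 ltW.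
  - exact: mp.
  rewrite ler_wpM2r ?lerDl// subr_ge0 lerXn2r ?nnegrE ?subr_ge0//; exact: ltW.
move/le_trans; apply.
have -> : sigma * ((d.*2.+1)%:R * (sigma + c) ^+ d / sigma * delta) =
    (d.*2.+1)%:R * (sigma + c) ^+ d * delta by field; rewrite gt_eqF.
(* The shell has thickness [2 * delta], whence the doubling of [d]. *)
have -> : d%:R * (sigma + delta) ^+ d * (sigma + delta - (sigma - delta)) =
   (d.*2)%:R * (sigma + delta) ^+ d * delta by rewrite -muln2 natrM; ring.
rewrite ler_wpM2r// ler_pM ?mulr_ge0 ?exprn_ge0 ?(ltW sd0)//.
by rewrite ler_nat.
Qed.

End annulus.

(** * Borel measurability of continuous functions *)

Section borel_rV.
Context (R : realType).

Lemma open_measurable_mx m n (U : set 'M[R]_(m, n)) : open U -> measurable U.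
Proof. by move=> oU; apply: sub_sigma_algebra. Qed.

Lemma continuous_measurable_mx m n (f : 'M[R]_(m, n) -> R) :
  continuous f -> measurable_fun [set: 'M[R]_(m, n)] f.
Proof.
move=> /continuousP cf; apply: (measurability _ (RGenOpens.measurableE R)).
move=> _ [_ [a [b ->] <-]]; rewrite setTI; apply: open_measurable_mx.
exact/cf/interval_open.
Qed.

Lemma continuous_sum (T : topologicalType) (I : Type) (r : seq I)
    (F : I -> T -> R) : (forall i, continuous (F i)) ->
  continuous (fun x => \sum_(i <- r) F i x).
Proof.
move=> cF; apply: continuous_big => // -[a b].
exact: add_continuous.
Qed.

Lemma fnorm_continuous m n : continuous (@fnorm R m n).
Proof.
move=> A; apply: (@continuous_comp _ _ _
  (fun A : 'M[R]_(m, n) => \sum_i \sum_j A i j ^+ 2)); last exact: sqrt_continuous.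
apply: continuous_sum => i; apply: continuous_sum => j B.
apply: (@continuous_comp _ _ _ (fun A : 'M[R]_(m, n) => A i j) (fun x => x ^+ 2)).
  exact: coord_continuous.
exact: exprn_continuous.
Qed.

Lemma fnorm_dist_continuous m n (x : 'M[R]_(m, n)) :
  continuous (fun y => fnorm (y - x)).
Proof.
move=> y; apply: (@continuous_comp _ _ _ (fun y => y - x)).
  exact: (@cvgB R 'M[R]_(m, n) _ (nbhs y) _ id (cst x) y x cvg_id (cvg_cst x)).
exact: fnorm_continuous.
Qed.

(** * A countable base of the product space, and null sets outside the support *)

Section rational_boxes.
Context (d : nat).
Implicit Types (q : 'rV[rat]_d * 'rV[rat]_d * nat) (U : set ('rV[R]_d * 'rV[R]_d)).

(** Two rational centres and an index for the common radius form a countable type. The balls are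
    those of the sup norm, so centres can be approximated coordinate by coordinate. *)
Definition rat_box q : set ('rV[R]_d * 'rV[R]_d) :=
  ball (map_mx ratr q.1.1 : 'rV[R]_d) q.2.+1%:R^-1 `*`
  ball (map_mx ratr q.1.2 : 'rV[R]_d) q.2.+1%:R^-1.

Lemma rat_box_measurable q : measurable (rat_box q).
Proof.
by apply: measurableX; apply: open_measurable_mx; exact: ball_open.
Qed.

Lemma rat_ball_approx (x : 'rV[R]_d) (e : R) : 0 < e ->
  exists q : 'rV[rat]_d, ball (map_mx ratr q : 'rV[R]_d) e x.
Proof.
move=> e0; have /choice[f fP] (i : 'I_d) :
    exists q : rat, ratr q \in `](x 0 i - e), (x 0 i + e)[.
  by apply: rat_in_itvoo; rewrite ltrD2l gtrN.
exists (\row_i f i); split=> // i j; rewrite !mxE ord1 /ball/=.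
by have := fP j; rewrite in_itv/= distrC ltr_distlC.
Qed.

Lemma rat_box_base U z : nbhs z U -> exists2 q, rat_box q z & rat_box q `<=` U.
Proof.
move=> /nbhs_ballP[e /= e0 eU].
(* With radius below [e / 2], a box containing [z] stays within distance [e] of [z]. *)
have [k ke] : exists k : nat, k.+1%:R^-1 < e / 2.
  have := near_infty_natSinv_lt (PosNum (divr_gt0 e0 (ltr0n _ 2))).
  by move=> [k _ /(_ k (leqnn k))] /=; exists k.
have k0 : 0 < k.+1%:R^-1 :> R by rewrite invr_gt0.
have [q1 q1z] := rat_ball_approx z.1 k0.
have [q2 q2z] := rat_ball_approx z.2 k0.
exists (q1, q2, k) => // w [/= w1 w2]; apply: eU.
have le2 : k.+1%:R^-1 + k.+1%:R^-1 <= e by rewrite (splitr e) lerD// ltW.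
by split; apply: (le_ball le2); [apply: ball_triangle (ball_sym q1z) w1|
  apply: ball_triangle (ball_sym q2z) w2].
Qed.

(** Enumeration through [unpickle], with the empty set for codes that are invalid or violate [P]. It
    serves twice: with [P] meaning inclusion in [U], and with [P] meaning measure zero. *)
Lemma open_bigcup_rat_box U (P : set ('rV[rat]_d * 'rV[rat]_d * nat)) :
  (forall z, U z -> exists2 q, P q & rat_box q z) ->
  exists2 F : (set ('rV[R]_d * 'rV[R]_d))^nat, U `<=` \bigcup_n F n &
    forall n, F n = set0 \/ exists2 q, P q & F n = rat_box q.
Proof.
move=> UP; exists (fun n => if unpickle n is Some q
    then if `[< P q >] then rat_box q else set0 else set0).
  move=> z /UP[q Pq qz]; exists (pickle q) => //.
  by rewrite pickleK asboolT.
move=> n; case: unpickle => [q|]; last by left.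
by case: asboolP => Pq; [right; exists q|left].
Qed.

(** Measurability here refers to the product sigma-algebra, which contains the open sets because
    they are countable unions of boxes. *)
Lemma open_measurable_prod U : open U -> measurable U.
Proof.
move=> oU; have [|F UF FP] := @open_bigcup_rat_box U [set q | rat_box q `<=` U].
  move=> z Uz; have [|q] := @rat_box_base U z; last by exists q.
  exact: open_nbhs_nbhs.
have -> : U = \bigcup_n F n.
  apply/seteqP; split=> // z [n _].
  by case: (FP n) => [->//|[q qU ->] /qU].
apply: bigcupT_measurable => n; case: (FP n) => [->//|[q _ ->]].
exact: rat_box_measurable.
Qed.

(* Lindelof: the open sets of measure zero outside the support are covered by
   countably many null rational boxes. *)
Lemma supp_null (mu : probability ('rV[R]_d * 'rV[R]_d)%type R) U :
  open U -> U `&` supp (mu : set ('rV[R]_d * 'rV[R]_d) -> \bar R) = set0 ->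
  mu U = 0%E.
Proof.
move=> oU U0; have [|F UF FP] := @open_bigcup_rat_box U [set q | mu (rat_box q) = 0%E].
  move=> z Uz; have : ~ supp (mu : set _ -> \bar R) z.
    by move=> sz; suff: set0 z by []; rewrite -U0.
  (* A point outside the support has a null open neighbourhood [V], and a rational box fits between
     the two. *)
  move=> /existsNP[V /not_implyP[oV /not_implyP[Vz /negP]]].
  rewrite -leNgt => V0; have [|q qz qV] := @rat_box_base V z.
    exact: open_nbhs_nbhs.
  exists q => //; apply/eqP; rewrite eq_le measure_ge0 andbT.
  apply: le_trans V0; rewrite le_measure// inE.
    exact: rat_box_measurable.
  exact: open_measurable_prod.
apply: measure_negligible; first exact: open_measurable_prod.
apply: negligibleS UF _; apply: negligible_bigcup => k.
case: (FP k) => [->|[q q0 ->]]; first exact: negligible_set0.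
by apply/negligibleP => //; exact: rat_box_measurable.
Qed.

End rational_boxes.
End borel_rV.

(** * Bounded integrands and passage from a marginal to the coupling *)

Lemma bounded_integrable dT (T : measurableType dT) (R : realType)
    (P : probability T R) (f : T -> R) (M : R) :
  measurable_fun [set: T] f -> (forall y, `|f y| <= M) ->
  P.-integrable setT (EFin \o f).
Proof.
move=> mf fM; apply: measurable_bounded_integrable => //.
  by rewrite -ge0_fin_numE ?fin_num_measure.
exists M; split; first exact: num_real.
by move=> N /ltW MN y _; exact: le_trans (fM y) MN.
Qed.

(** [alpha] is the image of [mu] under [phi]; the bound [M] supplies the integrability required by
    the image measure formula. *)
Lemma Rintegral_marginal dS dT (S : measurableType dS) (T : measurableType dT)
    (R : realType) (mu : probability S R) (alpha : probability T R)
    (phi : S -> T) (f : T -> R) (M : R) : measurable_fun [set: S] phi ->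
  (forall A, measurable A -> pushforward mu phi A = alpha A) ->
  measurable_fun [set: T] f -> (forall y, `|f y| <= M) ->
  \int[alpha]_y f y = \int[mu]_z f (phi z).
Proof.
move=> mphi phiE mf fM; congr fine.
rewrite (@eq_measure_integral _ _ _ _
    (measure_function_pushforward__canonical__measure_function_Measure mu mphi));
  last by move=> A mA _; exact/esym/phiE.
rewrite integral_pushforward//; first exact/measurable_EFinP.
rewrite preimage_setT.
apply: (@bounded_integrable _ _ _ _ (f \o phi) M); last by move=> z; exact: fM.
exact: measurableT_comp mf mphi.
Qed.

(** * Pointwise estimates for the entries of the truncated tensor *)

Section cov_kernel.
Context (R : realType) (d : nat) (sigma : R).
Hypothesis sigma_gt0 : 0 < sigma.
Implicit Types x y : 'rV[R]_d.
Local Notation nu := (unit_ball_volume R d).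
Local Notation k := (sigma ^+ d * nu)^-1.

Definition cov_kernel (i j : 'I_d) x y : R :=
  tensor (y - x) (y - x) i j * trunc_kernel x y sigma.

Lemma cov_kernelE i j x y : cov_kernel i j x y =
  k * ((y - x) 0 i * (y - x) 0 j * (fnorm (y - x) <= sigma)%R%:R).
Proof.
rewrite /cov_kernel /tensor /trunc_kernel mxE big_ord1 mxE mulrCA.
congr (_ * (_ * _)); rewrite indicE; congr (nat_of_bool _)%:R.
apply/idP/idP.
  rewrite inE/= in_itv/= => /andP[_].
  rewrite ler_pdivrMr ?exprn_gt0// mul1r ler_pXn2r ?nnegrE ?fnorm_ge0//.
  exact: ltW.
move=> ys; rewrite inE/= in_itv/= divr_ge0 ?sqr_ge0//=.
by rewrite ler_pdivrMr ?exprn_gt0// mul1r ler_pXn2r ?nnegrE ?fnorm_ge0// ltW.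
Qed.

Lemma kernel_scale_ge0 : 0 <= k.
Proof. by rewrite invr_ge0 mulr_ge0 ?exprn_ge0 ?unit_ball_volume_ge0// ltW. Qed.

Lemma fnorm_dist_measurable x (I : interval R) :
  measurable [set y | fnorm (y - x) \in I].
Proof.
rewrite -[X in measurable X]setTI.
exact: (continuous_measurable_mx (@fnorm_dist_continuous R 1 d x) measurableT
  (measurable_itv I)).
Qed.

Lemma annulus_measurable x a b : measurable (annulus x a b).
Proof. exact: (fnorm_dist_measurable x `]a, b]). Qed.

Lemma ball_measurable x : measurable [set y | fnorm (y - x) <= sigma].
Proof. exact: (fnorm_dist_measurable x `]-oo, sigma]). Qed.

Lemma coord_sub_measurable i x : measurable_fun setT (fun y => (y - x) 0 i).
Proof.
under eq_fun do rewrite !mxE.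
apply: measurable_funB => //; apply: continuous_measurable_mx.
exact: coord_continuous.
Qed.

Lemma cov_kernel_measurable i j x : measurable_fun setT (cov_kernel i j x).
Proof.
rewrite (_ : cov_kernel i j x = fun y => k * ((y - x) 0 i * (y - x) 0 j *
    \1_[set y | fnorm (y - x) <= sigma] y)); last first.
  apply/funext => y; rewrite cov_kernelE indicE; congr (_ * (_ * _%:R)).
  by congr nat_of_bool; apply/idP/idP; rewrite inE.
apply: measurable_funM => //; apply: measurable_funM; last first.
  by apply: measurable_indic; exact: ball_measurable.
by apply: measurable_funM; exact: coord_sub_measurable.
Qed.

Lemma cov_kernel_bounded i j x y : `|cov_kernel i j x y| <= k * sigma ^+ 2.
Proof.
rewrite cov_kernelE normrM ger0_norm ?kernel_scale_ge0// ler_wpM2l ?kernel_scale_ge0//.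
have [ys|_] := leP (fnorm (y - x)) sigma; last by rewrite mulr0 normr0 sqr_ge0.
by rewrite mulr1 normrM expr2 ler_pM// (le_trans (norm_coord_fnorm _ _ _)).
Qed.

Lemma cov_kernel_dist i j x y z (delta : R) : fnorm (y - z) <= delta ->
  `|cov_kernel i j x y - cov_kernel i j x z| <=
  k * (2 * sigma * delta * \1_[set y | fnorm (y - x) <= sigma] y +
       sigma ^+ 2 * \1_(annulus x (sigma - delta) (sigma + delta)) y).
Proof.
move=> yz; have delta0 : 0 <= delta by exact: le_trans (fnorm_ge0 _) yz.
rewrite !cov_kernelE -mulrBr normrM ger0_norm ?kernel_scale_ge0//.
rewrite ler_wpM2l ?kernel_scale_ge0//.
have xyz : fnorm (y - x) <= fnorm (z - x) + delta.
  have -> : y - x = (z - x) + (y - z) by rewrite [RHS]addrC addrA subrK.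
  by rewrite (le_trans (fnormD _ _))// lerD2l.
have xzy : fnorm (z - x) <= fnorm (y - x) + delta.
  have -> : z - x = (y - x) + (z - y) by rewrite [RHS]addrC addrA subrK.
  by rewrite (le_trans (fnormD _ _))// lerD2l -fnormN opprB.
have coord (w : 'rV[R]_d) l : fnorm w <= sigma -> `|w 0 l| <= sigma.
  by apply: le_trans; exact: norm_coord_fnorm.
(* Four cases, according to which of [y] and [z] survive truncation. If both do, the difference of
   products is split so that each term has one factor bounded by [sigma] and one by [delta]; if
   exactly one does, [y] lies in the shell. *)
have [ys|ys] := leP (fnorm (y - x)) sigma; have [zs|zs] := leP (fnorm (z - x)) sigma.
- rewrite !mulr1 [in leRHS]indicE mem_set// mulr1.
  have -> : (y - x) 0 i * (y - x) 0 j - (z - x) 0 i * (z - x) 0 j =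
      (y - x) 0 i * (y - z) 0 j + (z - x) 0 j * (y - z) 0 i.
    by rewrite !mxE; ring.
  apply: (@le_trans _ _ (2 * sigma * delta)); last first.
    by rewrite lerDl mulr_ge0 ?sqr_ge0.
  have yzl l : `|(y - z) 0 l| <= delta.
    by apply: le_trans yz; exact: norm_coord_fnorm.
  rewrite (le_trans (ler_normD _ _))// !normrM.
  have -> : 2 * sigma * delta = sigma * delta + sigma * delta by ring.
  by rewrite lerD// ler_pM// coord.
- rewrite mulr1 mulr0 subr0 [X in _ + _ * X]indicE mem_set; last first.
    rewrite /annulus/= ltrBlDr (lt_le_trans zs)//=.
    by rewrite (le_trans ys)// lerDl.
  rewrite mulr1 normrM (@le_trans _ _ (sigma ^+ 2))//.
    by rewrite expr2 ler_pM// coord.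
  by rewrite lerDr !mulr_ge0 ?(ltW sigma_gt0).
- rewrite mulr1 mulr0 sub0r normrN [X in _ + _ * X]indicE mem_set; last first.
    rewrite /annulus/= (le_trans xyz) ?lerD2r// andbT.
    by rewrite (le_lt_trans _ ys)// gerDl oppr_le0.
  rewrite mulr1 normrM (@le_trans _ _ (sigma ^+ 2))//.
    by rewrite expr2 ler_pM// coord.
  by rewrite lerDr !mulr_ge0 ?(ltW sigma_gt0).
- rewrite !mulr0 subr0 normr0.
  by rewrite addr_ge0 ?mulr_ge0 ?sqr_ge0 ?(ltW sigma_gt0).
Qed.

End cov_kernel.

(** * Supports of couplings *)

Section coupling_bound.
Context (R : realType) (d : nat).
Local Notation supp2 mu := (supp (mu : set ('rV[R]_d * 'rV[R]_d) -> \bar R)).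

(** An open neighbourhood of a projection of [z] pulls back to an open neighbourhood of [z], whose
    [mu]-mass is the marginal mass. *)
Lemma coupling_supp (alpha beta : probability 'rV[R]_d R) mu z :
  coupling alpha beta mu -> supp2 mu z ->
  supp (alpha : set _ -> \bar R) z.1 /\ supp (beta : set _ -> \bar R) z.2.
Proof.
move=> [mua mub] sz; split=> U oU Uz.
  rewrite -(mua _ (open_measurable_mx oU)); apply: sz => //.
  by apply: open_comp oU => w _; exact: cvg_fst.
rewrite -(mub _ (open_measurable_mx oU)); apply: sz => //.
by apply: open_comp oU => w _; exact: cvg_snd.
Qed.

(** Were the support empty, the whole space would be null. *)
Lemma coupling_supp_nonempty (mu : probability ('rV[R]_d * 'rV[R]_d)%type R) :
  supp2 mu !=set0.
Proof.
apply/set0P/eqP => s0; have := @supp_null R d mu setT openT.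
rewrite s0 setI0 probability_setT => /(_ erefl) /eqP.
by rewrite onee_eq0.
Qed.

Lemma supp_dist_ae (mu : probability ('rV[R]_d * 'rV[R]_d)%type R) (delta : R) :
  (forall z, supp2 mu z -> fnorm (z.1 - z.2) <= delta) ->
  {ae mu, forall z, fnorm (z.1 - z.2) <= delta}.
Proof.
move=> hd; have cf : continuous (fun z : 'rV[R]_d * 'rV[R]_d => fnorm (z.1 - z.2)).
  move=> z; apply: (@continuous_comp _ _ _
      (fun z : 'rV[R]_d * 'rV[R]_d => z.1 - z.2)); last exact: fnorm_continuous.
  exact: (@cvgB R 'rV[R]_d _ (nbhs z) _ fst snd z.1 z.2 cvg_fst cvg_snd).
have oU : open [set z : 'rV[R]_d * 'rV[R]_d | delta < fnorm (z.1 - z.2)].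
  have /continuousP/(_ [set t | delta < t]) := cf; apply; exact: open_gt.
exists [set z | delta < fnorm (z.1 - z.2)]; split.
- exact: open_measurable_prod.
- apply: supp_null => //; apply/seteqP; split=> // z [/= dz /hd].
  by rewrite leNgt dz.
- by move=> z /= /negP; rewrite -ltNge.
Qed.

(** * The integrated estimate for one coupling *)

Section estimate.
Variables (sigma c lambda delta : R) (alpha beta : probability 'rV[R]_d R).
Variable (mu : probability ('rV[R]_d * 'rV[R]_d)%type R).
Hypotheses (sigma_gt0 : 0 < sigma) (lambda_gt0 : 0 < lambda).
Hypotheses (delta_ge0 : 0 <= delta) (delta_le : delta <= c).
Hypothesis al : Pinfty_lambda lambda alpha.
Hypothesis cp : coupling alpha beta mu.
Hypothesis mu_delta : {ae mu, forall z, fnorm (z.1 - z.2) <= delta}.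
Local Notation nu := (unit_ball_volume R d).
Local Notation k := (sigma ^+ d * nu)^-1.

(** The two summands are the contributions of the ball and of the shell. The factors [k] and [nu]
    are left uncancelled, since cancelling would require [nu] to be nonzero. *)
Definition entry_const := k * (2 * sigma * (sigma ^+ d * nu) +
  sigma ^+ 2 * ((d.*2.+1)%:R * (sigma + c) ^+ d / sigma * nu)).

Let G (x y : 'rV[R]_d) := k * (2 * sigma * delta * \1_[set y | fnorm (y - x) <= sigma] y +
       sigma ^+ 2 * \1_(annulus x (sigma - delta) (sigma + delta)) y).

Let G_ge0 x y : 0 <= G x y.
Proof.
by rewrite mulr_ge0 ?kernel_scale_ge0// addr_ge0 ?mulr_ge0 ?sqr_ge0// ltW.
Qed.

Let G_measurable x : measurable_fun setT (G x).
Proof.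
apply: measurable_funM => //; apply: measurable_funD; apply: measurable_funM => //;
  apply: measurable_indic; [exact: ball_measurable|exact: annulus_measurable].
Qed.

Let G_int x : (\int[alpha]_y (G x y)%:E <= (lambda * (entry_const * delta))%:E)%E.
Proof.
have k0 := @kernel_scale_ge0 R d _ sigma_gt0.
have c0 : 0 <= 2 * sigma * delta by rewrite !mulr_ge0// ltW.
have mB := ball_measurable sigma x.
have mA := @annulus_measurable R d x (sigma - delta) (sigma + delta).
have GE y : (G x y)%:E = ((k * (2 * sigma * delta))%:E *
      (\1_[set y | fnorm (y - x) <= sigma] y)%:E +
    (k * sigma ^+ 2)%:E *
      (\1_(annulus x (sigma - delta) (sigma + delta)) y)%:E)%E.
  by rewrite -!EFinM -EFinD /G mulrDr !mulrA.
have mI (A : set 'rV[R]_d) (r : R) : measurable A ->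
    measurable_fun setT (fun y => (r%:E * (\1_A y)%:E)%E).
  move=> ?; apply: measurable_funeM; apply/measurable_EFinP.
  exact: measurable_indic.
have I0 (A : set 'rV[R]_d) (r : R) y : 0 <= r -> (0 <= r%:E * (\1_A y)%:E)%E.
  by move=> ?; rewrite mule_ge0// lee_fin.
have IE (A : set 'rV[R]_d) (r : R) : measurable A -> 0 <= r ->
    (\int[alpha]_y (r%:E * (\1_A y)%:E) = r%:E * alpha A)%E.
  move=> ? ?; rewrite ge0_integralZl_EFin//.
  - by rewrite integral_indic// setIT.
  - by apply/measurable_EFinP; exact: measurable_indic.
have kc0 : 0 <= k * (2 * sigma * delta) by rewrite mulr_ge0.
have ks0 : 0 <= k * sigma ^+ 2 by rewrite mulr_ge0 ?sqr_ge0.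
under eq_integral do rewrite GE.
rewrite ge0_integralD//; last 4 first.
- by move=> y _; exact: I0.
- exact: mI.
- by move=> y _; exact: I0.
- exact: mI.
rewrite !IE//.
have aB : (alpha [set y | (fnorm (y - x) <= sigma)%R] <=
    (lambda * (sigma ^+ d * nu))%:E)%E.
  apply: le_trans (al.2 _ mB) _.
  by rewrite lebesgue_rV_ball// lebesgue_rV_unit_ball -!EFinM.
have aA : (alpha (annulus x (sigma - delta) (sigma + delta)) <=
    (lambda * ((d.*2.+1)%:R * (sigma + c) ^+ d / sigma * nu * delta))%:E)%E.
  apply: le_trans (al.2 _ mA) _.
  by rewrite EFinM lee_pmul2l//; exact: lebesgue_rV_shell.
apply: le_trans (leeD (lee_wpmul2l _ aB) (lee_wpmul2l _ aA)) _.
- by rewrite lee_fin.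
- by rewrite lee_fin.
rewrite -!EFinM -EFinD lee_fin le_eqVlt; apply/orP; left; apply/eqP.
by rewrite /entry_const; ring.
Qed.

Lemma cov_field_entry_le x i j :
  `|(cov_field alpha x sigma - cov_field beta x sigma) i j| <=
  lambda * (entry_const * delta).
Proof.
pose K := @cov_kernel R d sigma i j x.
have mK : measurable_fun setT K by exact: cov_kernel_measurable.
have Kb y : `|K y| <= k * sigma ^+ 2 by exact: cov_kernel_bounded.
have m1 := @measurable_fst _ _ 'rV[R]_d 'rV[R]_d.
have m2 := @measurable_snd _ _ 'rV[R]_d 'rV[R]_d.
have mK1 : measurable_fun setT (K \o (@fst 'rV[R]_d 'rV[R]_d)).
  exact: measurableT_comp mK m1.
have mK2 : measurable_fun setT (K \o (@snd 'rV[R]_d 'rV[R]_d)).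
  exact: measurableT_comp mK m2.
have iK1 : mu.-integrable setT (EFin \o (K \o fst)).
  by apply: bounded_integrable mK1 _ => z; exact: Kb.
have iK2 : mu.-integrable setT (EFin \o (K \o snd)).
  by apply: bounded_integrable mK2 _ => z; exact: Kb.
(* Both integrals are rewritten against [mu], so that the kernels can be compared at paired
   points. *)
have -> : (cov_field alpha x sigma - cov_field beta x sigma) i j =
    \int[mu]_z (K z.1 - K z.2).
  rewrite !mxE (Rintegral_marginal m1 cp.1 mK Kb) (Rintegral_marginal m2 cp.2 mK Kb).
  by rewrite -RintegralB.
have mD : measurable_fun setT (fun z : 'rV[R]_d * 'rV[R]_d => K z.1 - K z.2).
  exact: measurable_funB.
have iD : mu.-integrable setT (EFin \o (fun z => K z.1 - K z.2)).
  by have := integrableB measurableT iK1 iK2.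
rewrite -lee_fin EFin_normr_Rintegral//.
apply: le_trans (le_abse_integral mu measurableT _) _.
  exact/measurable_EFinP.
apply: (@le_trans _ _ (\int[mu]_z (G x z.1)%:E)%E).
  apply: ae_ge0_le_integral => //.
  - by apply/measurable_EFinP; exact: measurableT_comp.
  - by move=> z _; rewrite lee_fin G_ge0.
  - by apply/measurable_EFinP; exact: measurableT_comp (G_measurable x) m1.
  - by apply: filterS mu_delta => z dz _; rewrite lee_fin; exact: cov_kernel_dist.
(* The majorant involves [z.1] only, so its integral against [mu] returns to the first marginal
   [alpha], where the density bound applies. *)
apply: le_trans (G_int x).
rewrite [leRHS](@eq_measure_integral _ _ _ _
    (measure_function_pushforward__canonical__measure_function_Measure mu m1));
  last by move=> A mA _; exact/esym/cp.1.
rewrite ge0_integral_pushforward//.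
- by apply/measurable_EFinP; exact: G_measurable.
- by move=> y _; rewrite lee_fin G_ge0.
Qed.

End estimate.
End coupling_bound.

(** * Choice of the constant and infimum over couplings *)

Theorem theorem3 (R : realType) (d : nat) (sigma c : R)
    (sigma_gt0 : 0 < sigma) (c_gt0 : 0 < c) :
  exists2 A : R, 0 < A &
    forall (lambda : R) (Om : set 'rV[R]_d), 0 < lambda ->
      compact Om -> (diam Om <= c%:E)%E ->
    forall alpha beta : probability 'rV[R]_d R,
      Pinfty_lambda lambda alpha -> Pinfty beta ->
      supp (alpha : set 'rV[R]_d -> \bar R) `<=` Om ->
      supp (beta : set 'rV[R]_d -> \bar R) `<=` Om ->
      (ereal_sup [set (fnorm (cov_field alpha x sigma - cov_field beta x sigma))%:E
                 | x in [set: 'rV[R]_d]]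
       <= (lambda * A)%:E * Winfty alpha beta)%E.
Proof.
have E0 : 0 <= entry_const d sigma c.
  have nu0 := unit_ball_volume_ge0 R d.
  rewrite mulr_ge0 ?kernel_scale_ge0// addr_ge0 ?mulr_ge0 ?exprn_ge0 ?invr_ge0//;
    by rewrite ?addr_ge0// ltW.
(* The factor [d] passes from entries to the Frobenius norm; adding 1 makes the constant positive
   even when the first term vanishes, as for [d = 0]. *)
exists (d%:R * entry_const d sigma c + 1); first by rewrite ltr_wpDl// mulr_ge0.
move=> lambda Om lambda_gt0 _ diamc alpha beta al _ sa sb.
have lA0 : 0 < lambda * (d%:R * entry_const d sigma c + 1).
  by rewrite mulr_gt0// ltr_wpDl// mulr_ge0.
(* Dividing by the positive constant leaves a lower bound on an infimum, to be checked for each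
   coupling. *)
apply: ge_ereal_sup => _ [x _ <-]; rewrite -lee_pdivrMl//.
apply: le_ereal_inf_tmp => _ [mu cp <-]; set D := ereal_sup _.
have DD z : supp (mu : set ('rV[R]_d * 'rV[R]_d) -> \bar R) z ->
    ((fnorm (z.1 - z.2))%:E <= D)%E.
  by move=> sz; apply: ereal_sup_ubound; exists z.
(* A supremum over an empty support would be [-oo]. *)
have D0 : (0 <= D)%E.
  have [z sz] := coupling_supp_nonempty mu.
  by apply: le_trans (DD _ sz); rewrite lee_fin fnorm_ge0.
have Dc : (D <= c%:E)%E.
  apply: ge_ereal_sup => _ [z sz <-]; apply: le_trans diamc.
  apply: ereal_sup_ubound; exists z => //.
  by have [/sa ? /sb ?] := coupling_supp cp sz; split.
have Dfin : D \is a fin_num.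
  by rewrite ge0_fin_numE// (le_lt_trans Dc)// ltry.
rewrite -(fineK Dfin) lee_pdivrMl// -EFinM lee_fin.
have dae : {ae mu, forall z, fnorm (z.1 - z.2) <= fine D}.
  by apply: supp_dist_ae => z /DD; rewrite -{1}(fineK Dfin) lee_fin.
have fD0 : 0 <= fine D by rewrite fine_ge0.
have fDc : fine D <= c by rewrite -lee_fin fineK.
have := fnorm_le_coord (cov_field_entry_le sigma_gt0 lambda_gt0 fD0 fDc al cp dae x).
move/le_trans; apply.
have -> : d%:R * (lambda * (entry_const d sigma c * fine D)) =
  lambda * (d%:R * entry_const d sigma c) * fine D by ring.
by rewrite ler_wpM2r// ler_wpM2l ?lerDl// ltW.
Qed.
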